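(* Let $\mathbb K$ be a field of characteristic zero. In the shuffle algebra $\mathbb K\langle\mathscr A\rangle$, for all $i\in\mathbb Z_+$ and $t\in\mathbb K$, $$\widetilde{\mathcal P}_i(\alpha_1,\dots,\alpha_i;t)=\mathcal B_i\bigl(\mathcal P_1(\alpha_1),\dots,\mathcal P_i(\alpha_1,\dots,\alpha_i),\,t-i+1\bigr),$$ where the polynomial $\mathcal B_i$ on the right-hand side is evaluated using the shuffle product.
   Context: $\mathbb Z_+=\{0,1,2,\dots\}$. $\mathscr A=\{\alpha_i:i\in\mathbb N\}$ is a countable alphabet and $\mathbb K\langle\mathscr A\rangle$ is the $\mathbb K$-vector space with basis all words in $\mathscr A$ (including the empty word $1$), made into a commutative unital algebra by the shuffle product: the shuffle product of words $\alpha_{i_1}\cdots\alpha_{i_r}$ and $\alpha_{i_{r+1}}\cdots\alpha_{i_{r+s}}$ is $\sum_\sigma\alpha_{i_{\sigma(1)}}\cdots\alpha_{i_{\sigma(r+s)}}$ over permutations $\sigma$ of $\{1,\dots,r+s\}$ with $\sigma^{-1}(1)<\cdots<\sigma^{-1}(r)$ and $\sigma^{-1}(r+1)<\cdots<\sigma^{-1}(r+s)$. Generalized displacement polynomials: $\widetilde{\mathcal P}_0:=1$ and, for $i\in\mathbb N$, $\widetilde{\mathcal P}_i(\alpha_1,\dots,\alpha_i;t)=\sum_{i_1+\cdots+i_k=i}p_{i_1,\dots,i_k}(t)\,\alpha_{i_k}\cdots\alpha_{i_1}\in\mathbb K\langle\mathscr A\rangle$ (letters multiplied by concatenation), where the sum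 runs over all $k\in\{1,\dots,i\}$ and all $(i_1,\dots,i_k)\in\mathbb N^k$ with sum $i$, and $p_{i_1,\dots,i_k}(t)=(t-i_1+1)(t-i_1-i_2+1)\cdots(t-i_1-\cdots-i_k+1)$. The displacement polynomials are $\mathcal P_i(\alpha_1,\dots,\alpha_i):=\widetilde{\mathcal P}_i(\alpha_1,\dots,\alpha_i;i)$. Polynomials $\mathcal B_k$: $\mathcal B_0:=1$ and, for $k\in\mathbb N$, $\mathcal B_k(t_1,\dots,t_k,t):=\sum_{l_1+2l_2+\cdots+kl_k=k}\Bigl(\prod_{l=1-l_1-\cdots-l_k}^{0}(t+l)\Bigr)\frac{t_1^{l_1}\cdots t_k^{l_k}}{l_1!\cdots l_k!}\in\mathbb Q[t_1,\dots,t_k,t]$, the sum over nonnegative integers $l_1,\dots,l_k$. *)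

(* Defs.v *)
From HB Require Import structures.
From mathcomp Require Import all_boot all_order all_fingroup all_algebra.
From mathcomp Require Import zify finmap.
From mathcomp.multinomials Require mpoly monalg.

Set Implicit Arguments.
Unset Strict Implicit.
Unset Printing Implicit Defensive.

Import GRing.Theory.
Local Open Scope ring_scope.

Section PolynomialsB.
Import mpoly.

(* The variable t_{j+1}, for j < k, is ['X_(lift ord_max j)], whose index has *)
(* value j, and t is ['X_ord_max]. In the sum, [l j] stands for l_{j+1}; the  *)
(* bound l_{j+1} <= k follows from the summation condition. The product over  *)
(* l from 1 - (l_1 + ... + l_k) to 0 is reindexed by l = - m.                 *)
Definition calB (k : nat) : {mpoly rat[k.+1]} :=
  \sum_(l : {ffun 'I_k -> 'I_k.+1} | (\sum_(j < k) j.+1 * l j)%N == k)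
    (((\prod_(j < k) (l j)`!)%N)%:R)^-1 *:
      ((\prod_(m < (\sum_(j < k) l j)%N) ('X_ord_max - m%:R)) *
       \prod_(j < k) 'X_(lift ord_max j) ^+ l j).

Lemma calB0 : calB 0 = 1.
Proof.
rewrite /calB (big_pred1 [ffun=> ord0]) => [|l]; last first.
  by rewrite /= big_ord0 eqxx; apply/esym/eqP/ffunP => -[].
by rewrite !big_ord0 invr1 scale1r mulr1.
Qed.

(* B_k(x_1, ..., x_k, y) in a commutative algebra over a field of             *)
(* characteristic zero, with x_{j+1} given by [x j].                          *)
Definition calB_eval (K : fieldType) (A : comAlgType K) (k : nat)
    (x : 'I_k -> A) (y : A) : A :=
  mmap (fun q : rat => (ratr q)%:A)
    (fun i : 'I_k.+1 => if unlift ord_max i is Some j then x j else y)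
    (calB k).

End PolynomialsB.

Import monalg.

(* The alphabet is {alpha_1, alpha_2, ...}; the letter alpha_i is encoded by  *)
(* the natural number i.-1, so that every natural number encodes exactly one  *)
(* letter.                                                                    *)
Notation word := (seq nat).
Definition letter (i : nat) : nat := i.-1.

(* Here [s i] is sigma(i+1) - 1, and the first block has [r] elements.        *)
Definition is_shuffle (n r : nat) (s : 'S_n) : bool :=
  [forall i : 'I_n, forall j : 'I_n,
    [&& i < j & (j < r) || (r <= i)] ==> (s^-1%g i < s^-1%g j)]%N.

(* A type alias of the space with basis the words, carrying the shuffle       *)
(* product.                                                                   *)
Definition shuffle_alg (K : comNzRingType) : Type := {malg K[word]}.

Fact assoc_step (V : zmodType) (m : V -> V -> V) (letter_op : nat -> V -> V)
    (a b c : nat) (u v w : V) :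
  left_distributive m +%R -> right_distributive m +%R ->
  (forall d x y, letter_op d (x + y) = letter_op d x + letter_op d y) ->
  (forall d e x y, m (letter_op d x) (letter_op e y) =
     letter_op d (m x (letter_op e y)) + letter_op e (m (letter_op d x) y)) ->
  let au := letter_op a u in let bv := letter_op b v in
  let cw := letter_op c w in
  m u (m bv cw) = m (m u bv) cw -> m au (m v cw) = m (m au v) cw ->
  m au (m bv w) = m (m au bv) w -> m au (m bv cw) = m (m au bv) cw.
Proof.
move=> mDl mDr opD opM au bv cw IHu IHv IHw.
have -> : m au (m bv cw) = letter_op a (m u (m bv cw)) +
    letter_op b (m au (m v cw)) + letter_op c (m au (m bv w)).
  rewrite [m bv cw]opM mDr [m au _]opM [m au (letter_op c _)]opM mDr opD.
  by rewrite addrACA !addrA.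
have -> : m (m au bv) cw = letter_op a (m (m u bv) cw) +
    letter_op b (m (m au v) cw) + letter_op c (m (m au bv) w).
  rewrite [m au bv]opM mDl [m _ cw]opM [m (letter_op b _) cw]opM mDl opD.
  by rewrite addrACA !addrA.
by rewrite IHu IHv IHw.
Qed.

Section ShuffleAlgebra.
Variable K : comNzRingType.

HB.instance Definition _ := GRing.Lmodule.copy (shuffle_alg K) {malg K[word]}.

Local Notation A := (shuffle_alg K).

Definition of_word (w : word) : A := << w >>.

Definition shuffle_words (u v : word) : A :=
  \sum_(s : 'S_(size u + size v) | is_shuffle (size u) s)
    of_word [seq nth 0%N (u ++ v) (s i) | i <- enum 'I_(size u + size v)].

Definition shuffle_one : A := of_word [::].

Definition shuffle_mul (x y : A) : A :=
  \sum_(u <- msupp x) \sum_(v <- msupp y) (x@_u * y@_v) *: shuffle_words u v.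

Definition linext (f : word -> A) (x : A) : A :=
  \sum_(w <- msupp x) x@_w *: f w.

Lemma linextEw f (d : {fset word}) (x : A) :
  (msupp x `<=` d)%fset -> linext f x = \sum_(w <- d) x@_w *: f w.
Proof.
move=> sxd; rewrite /linext; apply: big_fset_incl => // w _ wNx.
by rewrite mcoeff_outdom // scale0r.
Qed.

Lemma linextP f c (x y : A) : linext f (c *: x + y) = c *: linext f x + linext f y.
Proof.
pose d := (msupp x `|` msupp y `|` msupp (c *: x + y))%fset.
rewrite !(@linextEw f d).
- rewrite scaler_sumr -big_split /=; apply: eq_bigr => w _.
  by rewrite [_@_w]mcoeffD mcoeffZ scalerDl scalerA.
- by rewrite /d (fsubset_trans (fsubsetUr (msupp x) _)) ?fsubsetUl.
- by rewrite /d (fsubset_trans (fsubsetUl _ (msupp y))) ?fsubsetUl.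
- exact: fsubsetUr.
Qed.

HB.instance Definition _ f :=
  GRing.isLinear.Build K A A *:%R (linext f)
    (fun c x y => linextP f c x y).

Lemma linext_word f w : linext f (of_word w) = f w.
Proof.
rewrite (@linextEw f [fset w]%fset) ?msuppU_le //.
by rewrite big_seq_fset1 mcoeffUU scale1r.
Qed.

Lemma word_expand (x : A) : x = \sum_(w <- msupp x) x@_w *: of_word w.
Proof.
rewrite {1}(monalgE x); apply: eq_bigr => w _; apply/malgP => k.
by rewrite mcoeffZ !mcoeffU; case: eqP; rewrite ?mulr1 ?mulr0.
Qed.

Lemma lin_eq (f g : {linear A -> A}) :
  (forall w, f (of_word w) = g (of_word w)) -> f =1 g.
Proof.
move=> fg x; rewrite (word_expand x) !linear_sum.
by apply: eq_bigr => w _; rewrite !linearZ fg.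
Qed.

Lemma shuffle_mulE x y :
  shuffle_mul x y = linext (fun u => linext (shuffle_words u) y) x.
Proof.
apply: eq_bigr => u _; rewrite scaler_sumr.
by apply: eq_bigr => v _; rewrite scalerA.
Qed.

Lemma shuffle_mulEr x y :
  shuffle_mul x y = linext (fun v => linext (shuffle_words^~ v) x) y.
Proof.
rewrite /shuffle_mul exchange_big; apply: eq_bigr => v _; rewrite scaler_sumr.
by apply: eq_bigr => u _; rewrite scalerA mulrC.
Qed.

Lemma shuffle_mul_word u v :
  shuffle_mul (of_word u) (of_word v) = shuffle_words u v.
Proof. by rewrite shuffle_mulE !linext_word. Qed.

Lemma shuffle_mulPl y c (x1 x2 : A) :
  shuffle_mul (c *: x1 + x2) y = c *: shuffle_mul x1 y + shuffle_mul x2 y.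
Proof. by rewrite !shuffle_mulE linearP. Qed.

Lemma shuffle_mulPr x c (y1 y2 : A) :
  shuffle_mul x (c *: y1 + y2) = c *: shuffle_mul x y1 + shuffle_mul x y2.
Proof. by rewrite !shuffle_mulEr linearP. Qed.

Definition shuffle_mull (x : A) : A -> A := shuffle_mul x.
Definition shuffle_mulr (y : A) : A -> A := shuffle_mul^~ y.
HB.instance Definition _ x :=
  GRing.isLinear.Build K A A *:%R (shuffle_mull x) (shuffle_mulPr x).
HB.instance Definition _ y :=
  GRing.isLinear.Build K A A *:%R (shuffle_mulr y) (shuffle_mulPl y).

Definition word_cons (a : nat) : A -> A := linext (fun w => of_word (a :: w)).
HB.instance Definition _ a := GRing.Linear.on (word_cons a).

Definition shuffle_block (n r : nat) (t : word) : A :=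
  \sum_(s : 'S_n | is_shuffle r s)
    of_word [seq nth 0%N t (s i) | i <- enum 'I_n].

Lemma is_shuffleP n r (s : 'S_n) :
  reflect (forall i j : 'I_n, (i < j)%N -> (j < r)%N || (r <= i)%N ->
             (s^-1%g i < s^-1%g j)%N) (is_shuffle r s).
Proof.
apply: (iffP forallP) => [H i j ij jr | H i].
  by move/forallP: (H i) => /(_ j); rewrite ij jr.
by apply/forallP=> j; apply/implyP => /andP[ij jr]; apply: H.
Qed.

Lemma is_shuffle0 n r (s : 'S_n.+1) : (r <= n.+1)%N -> is_shuffle r s ->
  (s ord0 == 0 :> nat) && (0 < r)%N || (s ord0 == r :> nat).
Proof.
move=> rn /is_shuffleP H.
have [jr | jr | -> //] := ltngtP (s ord0) r; rewrite ?orbT //.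
- rewrite (leq_ltn_trans _ jr) // andbT orbF; apply: contraT => j0.
  have := H ord0 (s ord0); rewrite permK lt0n ltn0 => /(_ j0).
  by rewrite jr => /(_ isT).
- have rn' : (r < n.+1)%N by apply: ltn_trans jr _.
  have := H (Ordinal rn') (s ord0); rewrite permK ltn0 /= leqnn orbT.
  by move=> /(_ jr isT).
Qed.

Lemma is_shuffle_lift n r (j : 'I_n.+1) (s : 'S_n) :
  (j == 0 :> nat) && (0 < r)%N || (j == r :> nat) ->
  is_shuffle r (lift_perm ord0 j s) = is_shuffle (r - (j < r)) s.
Proof.
move=> jP.
have jE (k l : 'I_n) :
  (((l < r - (j < r)) || (r - (j < r) <= k)) =
   ((lift j l < r) || (r <= lift j k)))%N.
  by rewrite /= /bump; lia.
have sV := lift_permV ord0 j s.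
apply/is_shuffleP/is_shuffleP => H.
  move=> k l kl; rewrite jE => /(H (lift j k) (lift j l)).
  rewrite sV !lift_perm_lift /= !/(bump 0 _) !leq0n !add1n !ltnS; apply.
  by rewrite /bump; lia.
move=> k l; rewrite sV.
case: (unliftP j k) => [k' ->|->]; case: (unliftP j l) => [l' ->|->].
- rewrite !lift_perm_lift => kl; rewrite -jE => /H.
  rewrite /= !/(bump 0 _) !leq0n !add1n !ltnS; apply.
  by move: kl; rewrite /= /bump; lia.
- rewrite lift_perm_id lift_perm_lift /= /bump.
  by case/orP: jP => [/andP[/eqP-> r0]|/eqP->]; lia.
- by rewrite lift_perm_id lift_perm_lift /= /bump leq0n.
- by rewrite ltnn.
Qed.

Lemma shuffle_block_fiber n r (j : 'I_n.+1) (t : word) :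
  size t = n.+1 -> (j == 0 :> nat) && (0 < r)%N || (j == r :> nat) ->
  \sum_(s : 'S_n.+1 | is_shuffle r s && (s ord0 == j))
     of_word [seq nth 0%N t (s i) | i <- enum 'I_n.+1] =
  word_cons (nth 0%N t j)
    (shuffle_block n (r - (j < r)) (take j t ++ drop j.+1 t)).
Proof.
move=> st jP; rewrite (reindex (lift_perm ord0 j)); last first.
  pose ulsf i (s : 'S_n.+1) k := odflt k (unlift (s i) (s (lift i k))).
  have ulsfK i (s : 'S_n.+1) k: lift (s i) (ulsf i s k) = s (lift i k).
    rewrite /ulsf; have:= neq_lift i k.
    by rewrite -(can_eq (permK s)) => /unlift_some[] ? ? ->.
  have inj_ulsf: injective (ulsf ord0 _).
    move=> s; apply: can_inj (ulsf (s ord0) s^-1%g) _ => k'.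
    by rewrite {1}/ulsf ulsfK !permK liftK.
  exists (fun s => perm (inj_ulsf s)) => [s _ | s].
    by apply/permP=> k'; rewrite permE /ulsf lift_perm_lift lift_perm_id liftK.
  case/andP=> _ /eqP si0; apply/permP=> k.
  case: (unliftP ord0 k) => [k'|] ->; rewrite ?lift_perm_id //.
  by rewrite lift_perm_lift -si0 permE ulsfK.
rewrite linear_sum; apply: eq_big => [s | s _].
  by rewrite lift_perm_id eqxx andbT is_shuffle_lift.
rewrite [RHS]linext_word; congr of_word.
rewrite enum_ordSl /= lift_perm_id -map_comp; congr cons.
apply: eq_map => i /=; rewrite lift_perm_lift /= nth_cat size_take st ltn_ord.
rewrite /bump; case: ltnP => ij; first by rewrite nth_take.
by rewrite nth_drop addSn subnKC // add1n.
Qed.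

Lemma shuffle_block_rec n r (t : word) : size t = n.+1 -> (r <= n.+1)%N ->
  shuffle_block n.+1 r t =
  \sum_(j : 'I_n.+1 | (j == 0 :> nat) && (0 < r)%N || (j == r :> nat))
    word_cons (nth 0%N t j)
      (shuffle_block n (r - (j < r)) (take j t ++ drop j.+1 t)).
Proof.
move=> st rn; rewrite /shuffle_block.
rewrite (partition_big (fun s : 'S_n.+1 => s ord0)
  (fun j => (j == 0 :> nat) && (0 < r)%N || (j == r :> nat))) /=; last first.
  by move=> s; apply: is_shuffle0.
by apply: eq_bigr => j jP; rewrite shuffle_block_fiber.
Qed.

Lemma shuffle_wordsE u v n : n = (size u + size v)%N ->
  shuffle_words u v = shuffle_block n (size u) (u ++ v).
Proof. by move=> ->. Qed.

Lemma shuffle_words_nil : shuffle_words [::] [::] = of_word [::].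
Proof.
rewrite /shuffle_words (big_pred1 (1%g : 'S_0)); last first.
  by move=> s /=; rewrite [s]permS0 eqxx; apply/is_shuffleP => -[].
by rewrite (_ : enum _ = [::]) //; apply: size0nil; rewrite size_enum_ord.
Qed.

Lemma shuffle_words_nill v : shuffle_words [::] v = of_word v.
Proof.
elim: v => [|b v IHv]; first exact: shuffle_words_nil.
rewrite (@shuffle_wordsE _ _ (size v).+1) // shuffle_block_rec //.
rewrite (big_pred1 ord0) => [|j]; last by rewrite /= andbF.
by rewrite /= ?take0 ?drop0 /= -(@shuffle_wordsE [::]) // IHv [LHS]linext_word.
Qed.

Lemma shuffle_words_nilr u : shuffle_words u [::] = of_word u.
Proof.
elim: u => [|b u IHu]; first exact: shuffle_words_nil.
rewrite (@shuffle_wordsE _ _ (size u).+1) /= ?addn0 //.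
rewrite shuffle_block_rec //= ?size_cat ?addn0 //.
rewrite (big_pred1 ord0) => [|j]; last first.
  by rewrite /= andbT (ltn_eqF (ltn_ord j)) orbF.
rewrite /= ?take0 ?drop0 /= subn1 -shuffle_wordsE ?addn0 //.
by rewrite IHu [LHS]linext_word.
Qed.

Lemma shuffle_words_cons a u b v :
  shuffle_words (a :: u) (b :: v) =
    word_cons a (shuffle_words u (b :: v)) +
    word_cons b (shuffle_words (a :: u) v).
Proof.
rewrite (@shuffle_wordsE _ _ (size u + size v).+2) /= ?addnS //.
rewrite shuffle_block_rec //= ?size_cat /= ?addnS ?ltnS ?leqW ?leq_addr //.
have rP : ((size u).+1 < (size u + size v).+2)%N by rewrite !ltnS leq_addr.
rewrite (bigD1 ord0) //= (big_pred1 (Ordinal rP)) /=; last first.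
  move=> j; have -> : pred1 (Ordinal rP) j = (val j == (size u).+1) by [].
  rewrite -[j == ord0]val_eqE /=.
  by case: (nat_of_ord j) => [|m]; rewrite /= ?andbT.
rewrite ?take0 ?drop0 /= subn1 ltnn subn0 nth_cat ltnn subnn /=.
have dE : drop (size u).+1 (u ++ b :: v) = v.
  by rewrite drop_cat ltnNge leqnSn /= subSnn /= drop0.
rewrite dE (take_size_cat _ (erefl (size u))) -cat_cons.
rewrite -(@shuffle_wordsE u (b :: v)); last by rewrite /= addnS.
by rewrite -(@shuffle_wordsE (a :: u) v).
Qed.

Lemma shuffle_wordsC u v : shuffle_words u v = shuffle_words v u.
Proof.
elim: u v => [|a u IHu] v; first by rewrite shuffle_words_nill shuffle_words_nilr.
elim: v => [|b v IHv]; first by rewrite shuffle_words_nill shuffle_words_nilr.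
by rewrite !shuffle_words_cons IHu IHv addrC.
Qed.

Lemma shuffle_mulC : commutative shuffle_mul.
Proof.
move=> x y; rewrite shuffle_mulE shuffle_mulEr; apply: eq_bigr => u _.
by congr (_ *: _); apply: eq_bigr => v _; rewrite shuffle_wordsC.
Qed.

Lemma shuffle_mul1 : left_id shuffle_one shuffle_mul.
Proof.
move=> x; rewrite shuffle_mulE linext_word [RHS]word_expand.
by apply: eq_bigr => w _; rewrite shuffle_words_nill.
Qed.

Lemma shuffle_mulDl : left_distributive shuffle_mul +%R.
Proof. by move=> x y z; have := linearD (shuffle_mulr z) x y. Qed.

Lemma shuffle_mulDr : right_distributive shuffle_mul +%R.
Proof. by move=> x y z; have := linearD (shuffle_mull x) y z. Qed.

Lemma shuffle_mulZl c x y : shuffle_mul (c *: x) y = c *: shuffle_mul x y.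
Proof. by have := linearZZ (shuffle_mulr y) c x. Qed.

Lemma shuffle_mulZr c x y : shuffle_mul x (c *: y) = c *: shuffle_mul x y.
Proof. by have := linearZZ (shuffle_mull x) c y. Qed.

Lemma word_cons_word a w : word_cons a (of_word w) = of_word (a :: w).
Proof. exact: linext_word. Qed.

Lemma shuffle_mul_cons a b x y :
  shuffle_mul (word_cons a x) (word_cons b y) =
    word_cons a (shuffle_mul x (word_cons b y)) +
    word_cons b (shuffle_mul (word_cons a x) y).
Proof.
apply: (lin_eq (f := shuffle_mulr (word_cons b y) \o word_cons a)
  (g := (word_cons a \o shuffle_mulr (word_cons b y))
        \+ (word_cons b \o (shuffle_mulr y \o word_cons a)))) => u /=.
apply: (lin_eq (f := shuffle_mull (word_cons a (of_word u)) \o word_cons b)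
  (g := (word_cons a \o (shuffle_mull (of_word u) \o word_cons b))
        \+ (word_cons b \o shuffle_mull (word_cons a (of_word u))))) => v /=.
rewrite !word_cons_word /shuffle_mull !shuffle_mul_word.
exact: shuffle_words_cons.
Qed.

Lemma shuffle_mulA_word u v w :
  shuffle_mul (of_word u) (shuffle_mul (of_word v) (of_word w)) =
  shuffle_mul (shuffle_mul (of_word u) (of_word v)) (of_word w).
Proof.
elim: u v w => [|a u IHu] v w; first by rewrite !shuffle_mul1.
elim: v w => [|b v IHv] w.
  by rewrite shuffle_mul1 [shuffle_mul _ (of_word [::])]shuffle_mulC shuffle_mul1.
elim: w => [|c w IHw].
  by rewrite ![shuffle_mul _ (of_word [::])]shuffle_mulC !shuffle_mul1.
move: (IHu (b :: v) (c :: w)) (IHv (c :: w)) IHw.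
rewrite -!word_cons_word.
move: (of_word u) (of_word v) (of_word w) => {}u {}v {}w {}IHu {}IHv IHw.
have opD d x y : word_cons d (x + y) = word_cons d x + word_cons d y.
  by rewrite linearD.
exact: (assoc_step shuffle_mulDl shuffle_mulDr opD shuffle_mul_cons IHu IHv IHw).
Qed.

Lemma shuffle_mulA : associative shuffle_mul.
Proof.
move=> x y z.
apply: (lin_eq (f := shuffle_mulr (shuffle_mul y z))
               (g := shuffle_mulr z \o shuffle_mulr y)) => u.
apply: (lin_eq (f := shuffle_mull (of_word u) \o shuffle_mulr z)
               (g := shuffle_mulr z \o shuffle_mull (of_word u))) => v.
apply: (lin_eq (f := shuffle_mull (of_word u) \o shuffle_mull (of_word v))
               (g := shuffle_mull (shuffle_mul (of_word u) (of_word v)))) => w.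
exact: shuffle_mulA_word.
Qed.

Lemma shuffle_one_neq0 : shuffle_one != 0 :> A.
Proof. by rewrite monalgU_eq0 oner_eq0. Qed.

HB.instance Definition _ := GRing.Zmodule_isComNzRing.Build A
  shuffle_mulA shuffle_mulC shuffle_mul1 shuffle_mulDl shuffle_one_neq0.
HB.instance Definition _ := GRing.Lmodule_isLalgebra.Build K A
  (fun c x y => esym (shuffle_mulZl c x y)).
HB.instance Definition _ := GRing.Lalgebra_isComAlgebra.Build K A.

End ShuffleAlgebra.

(* The composition (i_1, ..., i_k) is the list [c]; [take j.+1 c] is          *)
(* (i_1, ..., i_{j+1}).                                                       *)
Definition disp_coef (K : comNzRingType) (c : seq nat) (t : K) : K :=
  \prod_(j < size c) (t - (sumn (take j.+1 c))%:R + 1).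

(* The word alpha_{i_k} ... alpha_{i_1}.                                      *)
Definition disp_word (c : seq nat) : word := rev [seq letter j | j <- c].

Definition gen_disp_poly (K : comNzRingType) (i : nat) (t : K) : shuffle_alg K :=
  if i is 0 then 1 else
  \sum_(1 <= k < i.+1)
    \sum_(c : k.-tuple 'I_i.+1
          | all (fun j : 'I_i.+1 => 0 < j)%N c && (sumn (map val c) == i))
      disp_coef (map val c) t *: of_word K (disp_word (map val c)).

Definition disp_poly (K : comNzRingType) (i : nat) : shuffle_alg K :=
  gen_disp_poly i (i%:R : K).

(* Main.v *)
From HB Require Import structures.
Require Import Defs.
From mathcomp Require Import all_boot all_order all_fingroup all_algebra.
From mathcomp Require Import ring zify finmap.
From mathcomp.multinomials Require mpoly monalg.

(* Put X(z) = 1 + \sum_(k >= 1) P_k z^k, a power series over the shuffle      *)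
(* algebra. Then B_k(P_1, ..., P_k, s) is the coefficient of z^k in X^s.      *)
(* Deleting a leading letter alpha_a is a derivation d_a of the shuffle       *)
(* product, and an element is determined by its constant term and its images  *)
(* under all d_a. One has d_a (Ptilde_i(t)) = (t - i + 1) Ptilde_(i-a)(t), so *)
(* that d_a P_k = Ptilde_(k-a)(k), which by induction on i is the coefficient *)
(* of z^(k-a) in X^(a+1) for k <= i. Hence d_a X = z^a X^(a+1) and            *)
(* d_a X^s = s z^a X^(s+a) up to order i: with s = t - i + 1, both sides of   *)
(* the theorem have the same image under d_a.                                 *)

Set Implicit Arguments.
Unset Strict Implicit.
Unset Printing Implicit Defensive.

Import GRing.Theory.
Local Open Scope ring_scope.

(** Powers of X with exponent s in K are represented by truncated binomial series in Y = X - 1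
    ([binser]), exact in all degrees below the truncation. [calB_evalE] recognizes B_k in X^s by the
    multinomial theorem. [map_poly_der_binser] is the power rule d_a X^s = s X^(s-1) d_a X; as d_a X
    is a power of z times a natural power of X, the law of exponents in [coef_binser_addn] turns
    this into s z^a X^(s+a). [word_popM] and [word_pop_gen_disp_poly] compute d_a on products and on
    Ptilde_i, and [eq_shuffle_alg] concludes. *)

(** * The multinomial theorem with divided powers *)

Section MultinomialExpansion.
Variables (R : comNzRingType) (g : nat -> R).
Hypothesis gP : forall n, g n * n`!%:R = 1.

Lemma invfact_mul n i : (i <= n)%N -> g (n - i) * g i = g n * 'C(n, i)%:R.
Proof.
move=> le_in; have := congr1 (fun m => m%:R : R) (bin_fact le_in).
rewrite !natrM /= => E.
transitivity (g (n - i) * g i * (g n * n`!%:R)); first by rewrite gP mulr1.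
rewrite -E.
transitivity (g n * 'C(n, i)%:R * (g i * i`!%:R) * (g (n - i) * (n - i)`!%:R)).
  by ring.
by rewrite !gP !mulr1.
Qed.

(** With [g l] = 1/l!, the factors are truncated exponentials of y_j z, and their product agrees
    below degree N with the exponential of (y_1 + ... + y_m) z. *)
Lemma coef_prod_divided_powers m (y : 'I_m -> R) N n : (n < N)%N ->
  (\prod_(j < m) \poly_(l < N) (g l * y j ^+ l))`_n =
  g n * (\sum_(j < m) y j) ^+ n.
Proof.
elim: m y n => [|m IHm] y n nN.
  rewrite !big_ord0 coef1; case: n nN => [|n] _; last by rewrite expr0n mulr0.
  by have := gP 0; rewrite fact0 expr0.
rewrite !big_ord_recr coefM /= exprDn mulr_sumr.
rewrite (reindex_inj rev_ord_inj) /=; apply: eq_bigr => i _.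
rewrite subSS subKn -1?ltnS // coef_poly (leq_ltn_trans _ nN) -1?ltnS //.
rewrite IHm ?(leq_ltn_trans (leq_subr _ _) nN) //.
by rewrite mulrACA invfact_mul -1?ltnS // -mulr_natl; ring.
Qed.

Lemma multinomial_expansion m (y : 'I_m -> R) N n : (n < N)%N ->
  g n * (\sum_(j < m) y j) ^+ n =
  \sum_(l : {ffun 'I_m -> 'I_N} | (\sum_(j < m) l j)%N == n)
    \prod_(j < m) (g (l j) * y j ^+ l j).
Proof.
move=> nN; rewrite -(coef_prod_divided_powers _ nN).
under eq_bigr do rewrite poly_def.
rewrite bigA_distr_bigA /= coef_sum [RHS]big_mkcond; apply: eq_bigr => l _.
under eq_bigr do rewrite -mul_polyC.
rewrite big_split -rmorph_prod prodrXr /= coefCM coefXn eq_sym.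
by case: eqP; rewrite ?mulr1 ?mulr0.
Qed.

End MultinomialExpansion.

(** * Binomial coefficients with upper entry in K *)

Section GenBinomial.
Variable K : fieldType.
Hypothesis K0 : [pchar K] =i pred0.

Definition gbin (s : K) (n : nat) : K := (\prod_(m < n) (s - m%:R)) / n`!%:R.

Lemma natrS_neq0 n : n.+1%:R != 0 :> K.
Proof. by rewrite (proj1 (pcharf0P K) K0). Qed.

Lemma natr_fact_neq0 n : n`!%:R != 0 :> K.
Proof. by rewrite -(prednK (fact_gt0 n)) natrS_neq0. Qed.

Lemma gbin0 s : gbin s 0 = 1.
Proof. by rewrite /gbin big_ord0 invr1 mulr1. Qed.

Lemma gbin0S n : gbin 0 n.+1 = 0.
Proof. by rewrite /gbin big_ord_recl subr0 !mul0r. Qed.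

Lemma gbinS_absorb s n : n.+1%:R * gbin s n.+1 = s * gbin (s - 1) n.
Proof.
rewrite /gbin big_ord_recl /= subr0 factS natrM.
under eq_bigr do rewrite /bump /= add1n -addn1 natrD opprD addrCA addrC.
field.
by rewrite natr_fact_neq0 -mulrS natrS_neq0.
Qed.

Lemma gbinS_pascal s n : gbin (s + 1) n.+1 = gbin s n.+1 + gbin s n.
Proof.
apply: (mulfI (natrS_neq0 n)); rewrite gbinS_absorb addrK mulrDr.
rewrite /gbin big_ord_recr /= factS natrM.
field.
by rewrite natr_fact_neq0 -mulrS natrS_neq0.
Qed.

End GenBinomial.

(** * Coefficients of polynomials up to a given degree *)

Section TruncatedCongruence.
Variable R : comNzRingType.
Implicit Types p q : {poly R}.

Lemma eq_coefM p p' q q' n :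
  (forall k, (k <= n)%N -> p`_k = p'`_k) ->
  (forall k, (k <= n)%N -> q`_k = q'`_k) ->
  (p * q)`_n = (p' * q')`_n.
Proof.
move=> pp' qq'; rewrite !coefM; apply: eq_bigr => j _.
by rewrite pp' ?qq' ?leq_subr // -ltnS.
Qed.

Lemma eq_coefXn p p' n m :
  (forall k, (k <= n)%N -> p`_k = p'`_k) -> (p ^+ m)`_n = (p' ^+ m)`_n.
Proof.
elim: m n => [|m IHm] n pp' //; rewrite !exprS; apply: eq_coefM => // k kn.
by apply: IHm => l lk; rewrite pp' // (leq_trans lk).
Qed.

Lemma coefXn_lt p k n : p`_0 = 0 -> (k < n)%N -> (p ^+ n)`_k = 0.
Proof.
elim: n k => // n IHn k p0 kn; rewrite exprS coefM big1 // => -[[|j] /= jk] _.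
  by rewrite p0 mul0r.
by rewrite IHn ?mulr0 //; lia.
Qed.

End TruncatedCongruence.

(** * Truncated binomial series and derivations *)

Section BinomialSeries.
Variables (K : fieldType) (A : comAlgType K).
Hypothesis K0 : [pchar K] =i pred0.
Implicit Types (s : K) (p q : {poly A}).

(* For p without constant term, the power series (1 + p)^s has the same       *)
(* coefficients as its truncation [binser s p M] in all degrees below M.      *)
Definition binser s p M : {poly A} := \sum_(n < M) (gbin s n)%:A *: p ^+ n.

Lemma eq_coef_binser s p p' M n :
  (forall k, (k <= n)%N -> p`_k = p'`_k) ->
  (binser s p M)`_n = (binser s p' M)`_n.
Proof.
move=> pp'; rewrite !coef_sum; apply: eq_bigr => m _.
by rewrite !coefZ (eq_coefXn _ pp').
Qed.

(** As p has no constant term, p^n starts in degree n, so the terms from n = M on do not reach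
    degree k. *)
Lemma coef_binser_widen s p M M' k : p`_0 = 0 -> (k < M)%N -> (M <= M')%N ->
  (binser s p M')`_k = (binser s p M)`_k.
Proof.
move=> p0 kM; elim: M' => [|M' IHM]; first by rewrite leqn0 => /eqP->.
rewrite leq_eqVlt => /predU1P[-> // |]; rewrite ltnS => MM'.
rewrite /binser big_ord_recr coefD /= IHM // coefZ coefXn_lt ?mulr0 ?addr0 //.
exact: leq_trans MM'.
Qed.

Lemma binser0 p M : binser 0 p M.+1 = 1.
Proof.
rewrite /binser big_ord_recl gbin0 !scale1r big1 ?addr0 // => i _.
by rewrite gbin0S !scale0r.
Qed.

(** Pascal's rule, summed; multiplication by p shifts the index, hence the truncation one lower in
    the last term. *)
Lemma binser_add1 s p M :
  binser (s + 1) p M.+1 = binser s p M.+1 + p * binser s p M.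
Proof.
rewrite /binser !big_ord_recl !gbin0 -addrA; congr (_ + _).
rewrite mulr_sumr -big_split /=; apply: eq_bigr => n _ /=.
by rewrite /bump /= add1n gbinS_pascal // !scalerDl exprS -scalerAr.
Qed.

Lemma coef_binser_addn s p M n k : p`_0 = 0 -> (k < M)%N ->
  (binser s p M * (1 + p) ^+ n)`_k = (binser (s + n%:R) p M)`_k.
Proof.
move=> p0; case: M => // M kM; elim: n s => [|n IHn] s.
  by rewrite mulr1 addr0.
rewrite exprS -[n.+1]add1n natrD addrA -IHn mulrA; apply: eq_coefM => // l lk.
rewrite binser_add1 mulrDr mulr1 mulrC !coefD; congr (_ + _).
(* The two truncations differ by a multiple of p^M, which after multiplication by p lies beyond
   degree l. *)
rewrite {1}/binser big_ord_recr mulrDr coefD /= -scalerAr -exprS coefZ.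
by rewrite coefXn_lt ?mulr0 ?addr0 // (leq_ltn_trans lk).
Qed.

Lemma coef_binser_nat p M n k : p`_0 = 0 -> (k < M)%N ->
  (binser n%:R p M)`_k = ((1 + p) ^+ n)`_k.
Proof.
move=> p0; case: M => // M kM.
by rewrite -[n%:R]add0r -coef_binser_addn // binser0 mul1r.
Qed.

Variable d : {linear A -> A}.
Hypothesis dM : forall x y, d (x * y) = d x * y + x * d y.
Local Notation D := (map_poly d).

Lemma map_poly_derM p q : D (p * q) = D p * q + p * D q.
Proof.
apply/polyP=> k; rewrite coefD !coefM coef_map coefM /= raddf_sum -big_split.
by apply: eq_bigr => j _ /=; rewrite dM !coef_map.
Qed.

Lemma derivation1 : d 1 = 0.
Proof.
apply: (@addrI _ (d 1)).
by rewrite addr0 -[in RHS](mulr1 1) dM mulr1 mul1r.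
Qed.

Lemma map_poly_derXn p n : D (p ^+ n.+1) = (p ^+ n * D p) *+ n.+1.
Proof.
elim: n => [|n IHn]; first by rewrite expr1 expr0 mul1r.
rewrite exprS map_poly_derM IHn [RHS]mulrS mulrC; congr (_ + _).
by rewrite mulrnAr mulrA -exprS.
Qed.

Lemma map_poly_derZ c p : D (c%:A *: p) = c%:A *: D p.
Proof.
apply/polyP=> k; rewrite !(coefZ, coef_map) /=.
by rewrite !mulr_algl linearZ.
Qed.

(** The power rule is exact for the truncations: by [gbinS_absorb], the term of index n+1 on the
    left becomes that of index n on the right. *)
Lemma map_poly_der_binser s p M :
  D (binser s p M.+1) = s%:A *: (binser (s - 1) p M * D p).
Proof.
rewrite /binser raddf_sum big_ord_recl /= expr0 map_poly_derZ.
have -> : D 1 = 0.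
  by rewrite (map_polyC d 1) /= derivation1 polyC0.
rewrite scaler0 add0r mulr_suml scaler_sumr; apply: eq_bigr => n _.
rewrite /= /bump /= add1n map_poly_derZ map_poly_derXn -scalerAl scalerA.
rewrite -scalerMnr scalerMnl; congr (_ *: _).
by rewrite mulr_algl scalerA -gbinS_absorb // mulr_natl scalerMnl.
Qed.

End BinomialSeries.

(** * The embedding of the rationals in characteristic zero *)

Section RationalEmbedding.
Variable K : fieldType.
Hypothesis K0 : [pchar K] =i pred0.

Lemma intr_eq0_pchar0 (z : int) : (z%:~R == 0 :> K) = (z == 0).
Proof.
case: z => n; first by rewrite -pmulrn (proj1 (pcharf0P K) K0).
by rewrite NegzE rmorphN /= !oppr_eq0 -pmulrn (negbTE (natrS_neq0 K0 n)).
Qed.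

(** [ratr] uses the reduced fraction; cross-multiplication allows any other one, since nonzero
    integers stay nonzero in K. *)
Lemma ratr_frac (a b : int) : b != 0 ->
  ratr (a%:~R / b%:~R) = a%:~R / b%:~R :> K.
Proof.
move=> b0; set r := _ / _ : rat; apply/eqP; rewrite /ratr.
rewrite eqr_div ?intr_eq0_pchar0 ?denq_neq0 // -!rmorphM /=.
apply/eqP; congr _%:~R; apply: (@intr_inj rat); rewrite !rmorphM /= numqE /r.
by field; rewrite intr_eq0.
Qed.

Lemma ratr_zmod_morphism_pchar0 : zmod_morphism (@ratr K).
Proof.
move=> x y; rewrite -[x]divq_num_den -[y]divq_num_den.
move: (numq x) (denq x) (denq_neq0 x) (numq y) (denq y) (denq_neq0 y).
move=> a b b0 c d d0; have bd0 : b * d != 0 by rewrite mulf_neq0.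
have -> : a%:~R / b%:~R - c%:~R / d%:~R =
          (a * d - c * b)%:~R / (b * d)%:~R :> rat.
  by rewrite rmorphB !rmorphM /=; field; rewrite !intr_eq0 b0 d0.
rewrite !ratr_frac // rmorphB !rmorphM /=.
by field; rewrite !intr_eq0_pchar0 b0 d0.
Qed.

Lemma ratr_monoid_morphism_pchar0 : monoid_morphism (@ratr K).
Proof.
split=> [|x y]; first exact: (ratr_nat K 1).
rewrite -[x]divq_num_den -[y]divq_num_den.
move: (numq x) (denq x) (denq_neq0 x) (numq y) (denq y) (denq_neq0 y).
move=> a b b0 c d d0; have bd0 : b * d != 0 by rewrite mulf_neq0.
rewrite mulf_div -!rmorphM /= !ratr_frac // !rmorphM /=.
by field; rewrite !intr_eq0_pchar0 b0 d0.
Qed.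

Lemma ratr_natV n : (0 < n)%N -> ratr n%:R^-1 = n%:R^-1 :> K.
Proof.
move=> n0; have := @ratr_frac 1 n; rewrite !div1r !pmulrn; apply.
by rewrite -lt0n.
Qed.

End RationalEmbedding.

(** * Evaluation of B_k in an algebra *)

Section EvaluationOfB.
Import mpoly.
Variables (K : fieldType) (A : comAlgType K).
Hypothesis K0 : [pchar K] =i pred0.

Lemma calB_eval_sum k (x : 'I_k -> A) s :
  calB_eval x s%:A =
  \sum_(l : {ffun 'I_k -> 'I_k.+1} | (\sum_(j < k) j.+1 * l j)%N == k)
    (\prod_(m < (\sum_(j < k) l j)%N) (s - m%:R))%:A *
    \prod_(j < k) (((l j)`!%:R^-1)%:A * x j ^+ l j).
Proof.
pose aM := GRing.isZmodMorphism.Build rat K ratr (ratr_zmod_morphism_pchar0 K0).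
pose mM :=
  GRing.isMonoidMorphism.Build rat K ratr (ratr_monoid_morphism_pchar0 K0).
pose phi : {rmorphism rat -> K} := HB.pack (@ratr K) aM mM.
(* With the coefficient map a ring morphism, evaluation commutes with sums and products. *)
pose f : {rmorphism rat -> A} := in_alg A \o phi.
rewrite /calB_eval; set h := fun i : 'I_k.+1 => _.
rewrite -[X in mmap X _ _]/(f : _ -> _) /calB.
have fE q : f q = (ratr q)%:A by [].
move: f fE => {phi aM mM} f fE; rewrite rmorph_sum; apply: eq_bigr => l _ /=.
rewrite mmapZ rmorphM mulrCA; congr (_ * _).
  rewrite rmorph_prod.
  rewrite -[RHS]/(in_alg A _) rmorph_prod; apply: eq_bigr => m _ /=.
  rewrite rmorphB rmorph_nat /= mmapX mmap1U /h unlift_none.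
  by rewrite scalerBl scaler_nat.
rewrite big_split /=; congr (_ * _); last first.
  rewrite rmorph_prod; apply: eq_bigr => j _.
  by rewrite rmorphXn /= mmapX mmap1U /h liftK.
rewrite fE ratr_natV ?prodn_gt0 // => [|j]; last exact: fact_gt0.
by rewrite natr_prod -prodfV -[LHS]/(in_alg A _) rmorph_prod.
Qed.

End EvaluationOfB.

(** * B_k as a coefficient of a binomial series *)

Section GeneratingFunctionOfB.
Variables (K : fieldType) (A : comAlgType K).
Hypothesis K0 : [pchar K] =i pred0.

(** Expanding Y^n by the multinomial theorem over {poly A}, the term of l has n = l_1 + ... + l_k
    and degree l_1 + 2 l_2 + ... + k l_k. The n! in [gbin s n] cancels, leaving the coefficients of
    B_k. *)
Lemma calB_evalE k N M (x : nat -> A) s : (k <= N)%N -> (k < M)%N ->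
  calB_eval (fun j : 'I_k => x j) s%:A =
  (binser s (\sum_(j < N) x j *: 'X^(j.+1)) M)`_k.
Proof.
move=> kN kM; pose Y n := \sum_(j < n) x j *: 'X^(j.+1).
have Y0 n : (Y n)`_0 = 0.
  by rewrite coef_sum big1 // => j _; rewrite coefZ coefXn mulr0.
have YE m : (m <= k)%N -> (Y N)`_m = (Y k)`_m.
  move=> mk; rewrite /Y -(subnKC kN) big_split_ord coefD [X in _ + X]coef_sum.
  rewrite [X in _ + X]big1 ?addr0 // => j _.
  by rewrite coefZ coefXn /= (_ : (m == _) = false) ?mulr0 //; lia.
rewrite -/(Y N) (eq_coef_binser _ _ YE).
rewrite (coef_binser_widen _ (Y0 _) (ltnSn k)) //.
pose g n : {poly A} := ((n`!%:R^-1)%:A)%:P.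
have gP n : g n * n`!%:R = 1.
  rewrite /g -polyC_natr -polyCM -[X in (_ * X)%:P](rmorph_nat (in_alg A)).
  by rewrite -(rmorphM (in_alg A)) mulVf ?natr_fact_neq0 // rmorph1.
rewrite calB_eval_sum // coef_sum.
(* The sum of the l_j is at most the weighted sum k ([le_wt]), so [inord] does not alter it. *)
rewrite (partition_big (fun l : {ffun 'I_k -> 'I_k.+1} =>
   inord (\sum_(j < k) l j)%N : 'I_k.+1) predT) //=.
apply: eq_bigr => n _; set c := \prod_(m < n) (s - m%:R).
have -> : (gbin s n)%:A *: Y k ^+ n = c%:A *: (g n * Y k ^+ n).
  rewrite mul_polyC scalerA; congr (_ *: _).
  exact: (rmorphM (in_alg A)).
rewrite /Y (multinomial_expansion gP _ (ltn_ord n)) coefZ coef_sum mulr_sumr.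
rewrite big_mkcond [RHS]big_mkcond; apply: eq_bigr => l _.
have le_wt : (\sum_(j < k) l j <= \sum_(j < k) j.+1 * l j)%N.
  by apply: leq_sum => j _; rewrite leq_pmull.
have -> : \prod_(j < k) (g (l j) * (x j *: 'X^(j.+1)) ^+ l j) =
    (\prod_(j < k) ((l j)`!%:R^-1%:A * x j ^+ l j))%:P *
    'X^(\sum_(j < k) j.+1 * l j).
  rewrite -prodrXr rmorph_prod -big_split; apply: eq_bigr => j _ /=.
  by rewrite exprZn -exprM -mul_polyC mulrA -polyCM.
rewrite coefCM coefXn [k == _]eq_sym.
case: eqP => [wt|_] /=; last by rewrite !mulr0 if_same.
rewrite mulr1 -val_eqE /= inordK; last by rewrite ltnS (leq_trans le_wt) ?wt.
by case: eqP => // ln; rewrite /c -ln.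
Qed.

End GeneratingFunctionOfB.

(** * Deletion of the leading letter as a derivation *)

Section LeadingLetter.
Import monalg.
Variable K : comNzRingType.
Local Notation A := (shuffle_alg K).
Implicit Types (a b : nat) (u v w : word) (x y : A).

(* The derivation d_a for the letter of code [a], that is, alpha_(a+1).       *)
Definition word_pop a : A -> A := linext (fun w =>
  if w is b :: w' then if b == a then of_word K w' else 0 else 0).
HB.instance Definition _ a := GRing.Linear.on (word_pop a).

Lemma mcoeff_of_word u w : (of_word K u)@_w = (u == w)%:R.
Proof. by rewrite mcoeffU. Qed.

Lemma mcoeff_linext f x w :
  (linext f x)@_w = \sum_(u <- msupp x) x@_u * (f u)@_w.
Proof. by rewrite raddf_sum; apply: eq_bigr => u _; rewrite /= mcoeffZ. Qed.

Lemma mcoeff_word_pop a x w : (word_pop a x)@_w = x@_(a :: w).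
Proof.
rewrite mcoeff_linext [in RHS](word_expand x) raddf_sum.
apply: eq_bigr => u _ /=; rewrite mcoeffZ mcoeff_of_word; congr (_ * _).
case: u => [|b u]; rewrite ?mcoeff0 // eqseq_cons.
by case: (b == a); rewrite ?mcoeff0 // mcoeff_of_word.
Qed.

Lemma word_pop_one a : word_pop a 1 = 0.
Proof. exact: linext_word. Qed.

Lemma word_pop_cons a b x :
  word_pop a (word_cons b x) = if b == a then x else 0.
Proof.
case: (eqVneq b a) => [<-|ba].
  apply: (lin_eq (f := word_pop b \o word_cons b) (g := idfun)) => w /=.
  by rewrite word_cons_word [LHS]linext_word eqxx.
apply: (lin_eq (f := word_pop a \o word_cons b) (g := \0)) => w /=.
by rewrite word_cons_word [LHS]linext_word (negbTE ba).
Qed.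

(** A shuffle of two nonempty words begins with the first letter of one of them
    ([shuffle_mul_cons]), which gives the two terms of the Leibniz rule. *)
Lemma word_popM a x y :
  word_pop a (x * y) = word_pop a x * y + x * word_pop a y.
Proof.
apply: (lin_eq (f := word_pop a \o shuffle_mulr y)
  (g := (shuffle_mulr y \o word_pop a) \+ shuffle_mulr (word_pop a y))) => u /=.
apply: (lin_eq (f := word_pop a \o shuffle_mull (of_word K u))
  (g := shuffle_mull (word_pop a (of_word K u))
        \+ (shuffle_mull (of_word K u) \o word_pop a))) => v /=.
rewrite /shuffle_mull -![shuffle_mul _ _]/(_ * _ : A).
case: u => [|b u].
  by rewrite -[of_word K [::]]/(1 : A) word_pop_one !mul1r mul0r add0r.
case: v => [|c v].
  by rewrite -[of_word K [::]]/(1 : A) word_pop_one !mulr1 mulr0 addr0.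
rewrite -!word_cons_word -{1}[_ * _]/(shuffle_mul _ _) shuffle_mul_cons.
rewrite linearD /= !word_pop_cons.
by do 2![case: eqP => _]; rewrite ?mul0r ?mulr0 ?addr0 ?add0r.
Qed.

Lemma mcoeff_nil_word_cons a x : (word_cons a x)@_[::] = 0.
Proof.
by rewrite mcoeff_linext big1 // => u _; rewrite mcoeff_of_word mulr0.
Qed.

Lemma mcoeff_nil_mul x y : x@_[::] = 0 -> (x * y)@_[::] = 0.
Proof.
move=> x0; rewrite raddf_sum big_seq big1 // => u ux.
rewrite raddf_sum big1 // => v _; rewrite /= mcoeffZ.
case: u ux => [|a u _]; first by rewrite -mcoeff_neq0 x0 eqxx.
case: v => [|b v]; first by rewrite shuffle_words_nilr mcoeff_of_word mulr0.
by rewrite shuffle_words_cons mcoeffD !mcoeff_nil_word_cons addr0 mulr0.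
Qed.

Lemma eq_shuffle_alg x y :
  x@_[::] = y@_[::] -> (forall a, word_pop a x = word_pop a y) -> x = y.
Proof.
move=> xy0 xyS; apply/malgP => -[|a w] //.
by rewrite -!mcoeff_word_pop xyS.
Qed.

End LeadingLetter.

(** * Coefficients of the generalized displacement polynomials *)

Section GeneralizedDisplacement.
Import monalg.
Variable K : comNzRingType.
Local Notation A := (shuffle_alg K).

Lemma disp_coef_rcons c b (t : K) :
  disp_coef (rcons c b) t = disp_coef c t * (t - (sumn (rcons c b))%:R + 1).
Proof.
rewrite /disp_coef size_rcons big_ord_recr /= take_oversize ?size_rcons //.
congr (_ * _); apply: eq_bigr => j _.
by rewrite -cats1 takel_cat.
Qed.

(** Every word comes from exactly one composition, its letter indices read backwards; [S] recovers
    the index from the code of a letter. *)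
Lemma mcoeff_gen_disp_poly i (t : K) w :
  (gen_disp_poly i t)@_w =
  if sumn (map S w) == i then disp_coef (rev (map S w)) t else 0.
Proof.
case: i => [|i].
  rewrite [LHS]mcoeff_of_word; case: w => [|a w] //=.
  by rewrite /disp_coef big_ord0.
set c0 := rev _; rewrite /gen_disp_poly.
have sc0 : sumn (map S w) = sumn c0 by rewrite sumn_rev.
have posc0 : all (ltn 0) c0 by rewrite all_rev all_map; apply/allP.
have wE : w = disp_word c0.
  by rewrite /disp_word map_rev revK -map_comp map_id.
rewrite sc0 wE; clearbody c0; clear w sc0 wE.
have disp_word_inj c :
    all (ltn 0) c -> (disp_word c == disp_word c0) = (c == c0).
  move=> posc; apply/eqP/eqP => [|-> //] /(can_inj revK) E.
  have K1 c1 : all (ltn 0) c1 -> map S (map letter c1) = c1.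
    by move=> /allP pc1; rewrite -map_comp map_id_in // => -[|j] /pc1.
  by rewrite -(K1 c) // E K1.
rewrite raddf_sum.
transitivity (\sum_(1 <= k < i.+2) \sum_(c : k.-tuple 'I_i.+2)
   (if (map val c == c0) && (sumn c0 == i.+1) then disp_coef c0 t else 0)).
  apply: eq_bigr => k _; rewrite raddf_sum big_mkcond; apply: eq_bigr => c _.
  rewrite /= mcoeffZ mcoeff_of_word.
  have -> : all (fun j : 'I_i.+2 => 0 < j)%N c = all (ltn 0) (map val c).
    by rewrite all_map.
  case: (eqVneq (map val c) c0) => [->|cN].
    by rewrite posc0 eqxx mulr1.
  case: ifP => // /andP[posc _].
  by rewrite disp_word_inj // (negbTE cN) mulr0.
case: (eqVneq (sumn c0) i.+1) => [sc0|_]; last first.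
  by rewrite big1 // => k _; rewrite big1 // => c _; rewrite andbF.
(* The parts of c0, and their number, are bounded by the sum i+1, so c0 does occur among the
   indexing tuples. *)
have lec0 j : j \in c0 -> (j < i.+2)%N.
  rewrite ltnS -sc0; elim: (c0) => //= a s IHs; rewrite inE.
  by move=> /predU1P[->|/IHs]; lia.
have szc0 : (0 < size c0 < i.+2)%N.
  rewrite ltnS -sc0; move: posc0 sc0; case: (c0) => //= a s /andP[a0 pos_s] _.
  suff: (size s <= sumn s)%N by lia.
  by elim: s pos_s => //= b s IHs /andP[b0 /IHs]; lia.
rewrite (bigD1_seq (size c0)) ?iota_uniq ?mem_index_iota //= [X in _ + X]big1.
  rewrite addr0 -big_mkcond /=.
  pose c : (size c0).-tuple 'I_i.+2 := map_tuple inord (in_tuple c0).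
  have cE : map val c = c0.
    by rewrite /= -map_comp map_id_in // => j /lec0 /inordK.
  rewrite (big_pred1 c) // => c' /=; rewrite andbT.
  transitivity (map val c' == map val c); first by rewrite cE.
  by rewrite (inj_eq (inj_map val_inj)).
move=> k kN; rewrite big1 // => c _; case: eqP => // E.
by rewrite -E size_map size_tuple eqxx in kN.
Qed.

(** The leading letter records the last part of the composition. Deleting it removes the last factor
    of the coefficient, which is t - i + 1 because all parts sum to i. *)
Lemma word_pop_gen_disp_poly a i (t : K) :
  word_pop a (gen_disp_poly i t) =
  if (a < i)%N then (t - i%:R + 1) *: gen_disp_poly (i - a.+1) t else 0.
Proof.
apply/malgP => w; rewrite mcoeff_word_pop mcoeff_gen_disp_poly /=.
case: ltnP => ai.
  rewrite mcoeffZ mcoeff_gen_disp_poly.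
  rewrite (_ : (sumn _ == i - a.+1) = (a.+1 + sumn (map S w) == i))%N; last lia.
  case: eqP => [<-|_]; last by rewrite mulr0.
  by rewrite rev_cons disp_coef_rcons mulrC -rev_cons sumn_rev.
by rewrite mcoeff0 ifF //; lia.
Qed.

End GeneralizedDisplacement.

(** * Constant terms *)

Lemma mcoeff_nil_gen_disp_poly (K : comNzRingType) i (t : K) :
  monalg.mcoeff [::] (gen_disp_poly i.+1 t) = 0.
Proof. by rewrite mcoeff_gen_disp_poly. Qed.

Section ConstantTerm.
Import monalg.

Lemma mcoeff_nil_binser (K : fieldType) (p : {poly shuffle_alg K}) s M n :
  (forall k, (p`_k)@_[::] = 0) -> ((binser s p M)`_n.+1)@_[::] = 0.
Proof.
move=> p0; rewrite coef_sum raddf_sum big1 // => -[m _] _ /=.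
rewrite coefZ mulr_algl mcoeffZ.
case: m => [|m]; first by rewrite coef1 mcoeff0 mulr0.
rewrite exprS coefM raddf_sum big1 ?mulr0 // => j _.
exact: mcoeff_nil_mul.
Qed.

End ConstantTerm.

(** * Induction on the degree *)

Theorem theorem6p4 (K : fieldType) (K0 : [pchar K] =i pred0) (i : nat) (t : K) :
  gen_disp_poly i t =
  @calB_eval K (shuffle_alg K) i (fun j : 'I_i => disp_poly K j.+1)
    (t - i%:R + 1)%:A.
Proof.
pose P j : shuffle_alg K := disp_poly K j.+1.
have BE k N M := @calB_evalE K (shuffle_alg K) K0 k N M P.
elim/ltn_ind: i t => i IHi t.
pose Y : {poly shuffle_alg K} := \sum_(j < i) P j *: 'X^(j.+1).
have YE k : Y`_k = if (0 < k <= i)%N then disp_poly K k else 0.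
  rewrite coef_sum; case: ifP => [|kN].
    case: k => // k ki; rewrite (bigD1 (Ordinal ki)) //= coefZ coefXn.
    rewrite eqxx mulr1 big1 ?addr0 // => j jk; rewrite coefZ coefXn eqSS eq_sym.
    by move: jk; rewrite -val_eqE => /negbTE ->; rewrite mulr0.
  rewrite big1 // => j _; rewrite coefZ coefXn; case: eqP => [kj|_].
    by move: kN (ltn_ord j); rewrite kj /= => ->.
  by rewrite mulr0.
have Y0 : Y`_0 = 0 by rewrite YE.
(* The power rule lowers the truncation by one; starting from i+2 leaves i+1, still exact in degree
   i. *)
pose s := t - i%:R + 1; rewrite (BE i i i.+2) //= -/Y -/s.
have IH k u : (k < i)%N ->
    gen_disp_poly k u = (binser (u - k%:R + 1) Y i.+1)`_k.
  by move=> ki; rewrite IHi // (BE k i i.+1) // ltnW // ltnW.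
case: (posnP i) => [i0|i_gt0].
  rewrite {}i0 in Y YE Y0 s {IHi IH} *.
  rewrite (@coef_binser_widen _ _ _ _ 1) // /binser big_ord1 gbin0 !scale1r.
  by rewrite coef1.
apply: eq_shuffle_alg => [|a].
  rewrite -(prednK i_gt0) mcoeff_nil_gen_disp_poly.
  rewrite mcoeff_nil_binser // => -[|k].
    by rewrite Y0 monalg.mcoeff0.
  by rewrite YE; case: ifP => _;
    rewrite ?monalg.mcoeff0 ?mcoeff_nil_gen_disp_poly.
rewrite word_pop_gen_disp_poly.
(* This is d X = z^(a+1) X^(a+2) up to degree i, where [a] is the code of alpha_(a+1). *)
have DY k : (k <= i)%N ->
    (map_poly (word_pop a) Y)`_k = ('X^(a.+1) * (1 + Y) ^+ a.+2)`_k.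
  move=> ki; rewrite coef_map /= YE ki andbT coefXnM ltnS.
  case: k ki => [|k] ki; first exact: (linear0 (word_pop a)).
  (* At t = k+1 the factor t - (k+1) + 1 is 1, so only Ptilde_(k-a)(k+1) remains, of degree below
     i. *)
  rewrite /disp_poly [if _ then _ else _]/= -[LHS]/(word_pop a _).
  rewrite word_pop_gen_disp_poly ltnS subrr add0r scale1r subSS.
  case: leqP => // ak; rewrite IH; last lia.
  rewrite -(coef_binser_nat K0 _ Y0 (M := i.+1)); last lia.
  suff -> : k.+1%:R - (k - a)%:R + 1 = a.+2%:R :> K by [].
  by rewrite natrB //; ring.
pose d := word_pop a : {linear shuffle_alg K -> shuffle_alg K}.
have dM : forall x y, d (x * y) = d x * y + x * d y by exact: word_popM.
have -> : word_pop a (binser s Y i.+2)`_i = (map_poly d (binser s Y i.+2))`_i.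
  by rewrite coef_map.
rewrite map_poly_der_binser // coefZ mulr_algl.
rewrite (eq_coefM (p' := binser (s - 1) Y i.+1) _ DY) //.
rewrite mulrCA coefXnM [(i < _)%N]ltnNge.
case: leqP => ai /=; first by rewrite scaler0.
rewrite coef_binser_addn //; last lia.
rewrite IH; last lia.
(* The exponent of X^(s-1) X^(a+2) is the one that the induction hypothesis gives in degree
   i-a-1. *)
suff -> : s - 1 + a.+2%:R = t - (i - a.+1)%:R + 1 by [].
by rewrite /s natrB //; ring.
Qed.
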